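(* For every integer $n>1$, the cordial edge deficiency of the complete graph $K_n$ is $ced(K_n)=\left\lfloor \frac{n}{2}\right\rfloor-1$.
   Context: Graphs are finite and may have multiple edges but not loops. A binary labeling of a graph $G$ is a function $f:V(G)\to\{0,1\}$. Two real numbers $x,y$ are roughly equal if $0\le |x-y|\le 1$. A binary labeling $f$ is friendly if $|f^{-1}(0)|$ and $|f^{-1}(1)|$ are roughly equal. A binary labeling $f$ induces an edge labeling $f_e:E(G)\to\{0,1\}$ by $f_e(uv)=f(u)+f(v)$ modulo 2. A friendly labeling $f$ of $G$ is cordial if $|f_e^{-1}(0)|$ and $|f_e^{-1}(1)|$ are roughly equal. The cordial edge deficiency $ced(G)$ is the minimum, over all friendly labelings $f$ of $G$, of the number of edges that must be added to $G$ between pairs of distinct vertices of $G$ (multiple edges allowed) so that $f$ becomes a cordial labeling of the augmented graph $G'$. *)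

(* Defs.v *)
From mathcomp Require Import all_boot all_order all_algebra.
Set Implicit Arguments.
Unset Strict Implicit.
Unset Printing Implicit Defensive.
Import Order.TTheory GRing.Theory Num.Theory.

(* Two-element sets of vertices: the possible positions of a non-loop edge. *)
Definition vpair (V : finType) := {A : {set V} | #|A| == 2}.

(* Finite loopless multigraphs: [ends] need not be injective. *)
Record mgraph := MGraph {
  vertex : finType;
  edge : finType;
  ends : edge -> vpair vertex
}.

Definition complete_graph (n : nat) : mgraph := @MGraph 'I_n (vpair 'I_n) id.

(* G with k extra edges, the i-th one joining the two vertices in h i. *)
Definition add_edges (G : mgraph) (k : nat) (h : 'I_k -> vpair (vertex G)) :
    mgraph :=
  @MGraph (vertex G) (edge G + 'I_k)%type
    (fun e => match e with inl e0 => ends e0 | inr i => h i end).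

(* Used only on cardinalities, hence stated on natural numbers, with the
   difference taken in int since subtraction on nat is truncated. *)
Definition roughly_equal (x y : nat) : bool :=
  (0 <= `|x%:Z - y%:Z| <= 1)%R.

Section Labelings.

Variable G : mgraph.

(* The labels 0 and 1 are false and true. *)
Definition labeling := {ffun vertex G -> bool}.

Definition edge_label (f : labeling) (e : edge G) : bool :=
  odd (\sum_(v in val (ends e)) f v).

Definition friendly (f : labeling) : bool :=
  roughly_equal #|[set v | f v == false]| #|[set v | f v == true]|.

Definition cordial (f : labeling) : bool :=
  friendly f &&
  roughly_equal #|[set e | edge_label f e == false]|
                #|[set e | edge_label f e == true]|.

End Labelings.

Definition is_minimum (P : nat -> Prop) (k : nat) : Prop :=
  P k /\ forall j, P j -> k <= j.

(* k is the least number of edges whose addition makes f cordial.  There may be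
   no such k, e.g. for three parallel edges on two vertices; this is why
   [is_deficiency] and [is_ced] are relations rather than functions. *)
Definition is_deficiency (G : mgraph) (f : labeling G) : nat -> Prop :=
  is_minimum (fun k =>
    exists h : 'I_k -> vpair (vertex G), cordial (G := add_edges h) f).

(* is_ced G k means ced(G) = k. *)
Definition is_ced (G : mgraph) : nat -> Prop :=
  is_minimum (fun k => exists2 f : labeling G, friendly f & is_deficiency f k).

Lemma is_ced_unique (G : mgraph) (k1 k2 : nat) :
  is_ced G k1 -> is_ced G k2 -> k1 = k2.
Proof.
move=> [P1 min1] [P2 min2].
by apply/eqP; rewrite eqn_leq min1 // min2.
Qed.

(* Main.v *)
Require Import Defs.
From mathcomp Require Import all_boot all_order all_algebra.
From mathcomp Require Import zify.

(** A friendly labeling of K_n has n/2 (rounded down and up) vertices with each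
    label, so with m = floor(n/2) there are m * (n - m) edges labeled 1, and
    'C(n, 2) - m * (n - m) edges labeled 0, which is m fewer for either parity
    of n.  Adding j edges closes this gap by at most j, hence m - 1 edges are
    needed; m - 1 edges joining two vertices with the same label suffice, and
    such vertices exist as soon as m > 1. *)

Lemma roughly_equalE (x y : nat) :
  roughly_equal x y = (x <= y.+1) && (y <= x.+1).
Proof. by rewrite /roughly_equal; apply/idP/idP; lia. Qed.

Lemma card_set_sum (A B : finType) (p : pred (A + B)) :
  #|[set e | p e]| = #|[set a | p (inl a)]| + #|[set b | p (inr b)]|.
Proof. by rewrite -!sum1dep_card big_sumType. Qed.

Lemma card_label_compl (T : finType) (g : T -> bool) :
  #|[set x | g x == false]| + #|[set x | g x == true]| = #|T|.
Proof.
rewrite addnC -(cardsC [set x | g x == true]); congr (_ + #|pred_of_set _|).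
by apply/setP=> x; rewrite !inE; case: (g x).
Qed.

Lemma odd_sum_pair (T : finType) (g : T -> bool) (x y : T) :
  x != y -> odd (\sum_(v in [set x; y]) g v) = g x (+) g y.
Proof.
by move=> xy; rewrite big_setU1 ?inE //= big_set1 oddD !oddb.
Qed.

Lemma card_vpair (V : finType) : #|{: vpair V}| = 'C(#|V|, 2).
Proof.
by rewrite card_sig -card_draws; apply: eq_card => A; rewrite !inE.
Qed.

(** An edge is labeled 1 iff its ends carry different labels, so listing the 0-end first makes [(x,
    y) |-> [set x; y]] a bijection from [setX F T] onto these edges. *)
Lemma card_edges_label1 (n : nat) (f : labeling (complete_graph n)) :
  #|[set e | edge_label f e == true]| =
    #|[set v | f v == false]| * #|[set v | f v == true]|.
Proof.
set F := [set v | f v == false]; set T := [set v | f v == true].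
rewrite -(card_imset _ val_inj) -cardsX.
have inj : {in setX F T &, injective (fun p : 'I_n * 'I_n => [set p.1; p.2])}.
  move=> [x y] [x' y'] /setXP[/= xF yT] /setXP[/= x'F y'T] /setP eqA.
  move: xF yT x'F y'T; rewrite !inE => /eqP xF /eqP yT /eqP x'F /eqP y'T.
  (* The two ends cannot be swapped, since [x] and [y'] have different labels. *)
  have := eqA x; rewrite !inE eqxx => /esym/orP[/eqP -> | /eqP xy']; last first.
    by rewrite xy' y'T in xF.
  have := eqA y; rewrite !inE eqxx orbT => /esym/orP[/eqP yx' | /eqP -> //].
  by rewrite yx' x'F in yT.
rewrite -(card_in_imset inj); apply: eq_card => A.
apply/imsetP/imsetP => [[e] | [[x y] /setXP[/=]]].
  rewrite inE /edge_label /= => + ->; case: e => B /= /cards2P[x [y [xy ->]]].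
  rewrite odd_sum_pair // => /eqP fxy.
  case fx: (f x) fxy => /= fy.
    by exists (y, x); rewrite /= ?inE /= 1?setUC // fx; move: fy; case: (f y).
  by exists (x, y); rewrite // !inE /= fx fy.
rewrite !inE => /eqP fx /eqP fy ->.
have xy : x != y by apply/eqP => xy; rewrite xy fy in fx.
have sz : #|[set x; y]| == 2 by rewrite cards2 xy.
exists (Sub [set x; y] sz : vpair 'I_n) => //.
by rewrite inE /edge_label /= odd_sum_pair // fx fy.
Qed.

(** With [a] and [b] vertices of each label and [z] edges labeled 0, twice the gap is 2(ab - z) =
    4ab - n(n - 1) = n - (a - b)^2, where (a - b)^2 is the parity of n. *)
Lemma friendly_edge_gap (n : nat) (f : labeling (complete_graph n)) :
  friendly f ->
  #|[set e | edge_label f e == true]| =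
    #|[set e | edge_label f e == false]| + n %/ 2.
Proof.
rewrite /friendly roughly_equalE => /andP[].
have := card_label_compl _ f; have := card_label_compl _ (edge_label f).
rewrite card_edges_label1 /= card_vpair card_ord bin2.
set a := #|[set v | f v == false]|; set b := #|[set v | f v == true]|.
set z := #|_|; move=> zE abn ab ba.
(* The halving in [bin2] is exact because n(n - 1) is even. *)
have := odd_double_half (n * n.-1); rewrite oddM.
have -> : odd n && odd n.-1 = false
  by case: n {f a b z zE abn ab ba} => //= n; case: odd.
have nn : n * n.-1 + n = (a + b) * (a + b).
  by rewrite abn -mulnSr; case: n {f a b z zE abn ab ba}.
have [e | [e | e]] : a = b \/ a = b.+1 \/ b = a.+1 by lia.
all: move: zE nn abn; rewrite e; lia.
Qed.

(** The edges of K_n enter only through their surplus [n %/ 2] of label 1, so cordiality becomes a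
    condition on the new edges. *)
Lemma cordial_add_edgesE (n k : nat) (f : labeling (complete_graph n))
    (h : 'I_k -> vpair 'I_n) :
  friendly f ->
  cordial (G := @add_edges (complete_graph n) k h) f =
    roughly_equal #|[set i | odd (\sum_(v in val (h i)) f v) == false]|
      (n %/ 2 + #|[set i | odd (\sum_(v in val (h i)) f v) == true]|).
Proof.
move=> fF; rewrite /cordial.
have -> : friendly (G := @add_edges (complete_graph n) k h) f by [].
have gap := friendly_edge_gap _ _ fF.
rewrite andTb !card_set_sum !roughly_equalE /edge_label /= in gap *.
rewrite gap; lia.
Qed.

Lemma cordial_add_edges_ge (n k : nat) (f : labeling (complete_graph n))
    (h : 'I_k -> vpair 'I_n) :
  friendly f -> cordial (G := @add_edges (complete_graph n) k h) f ->
  n %/ 2 - 1 <= k.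
Proof.
move=> fF; rewrite cordial_add_edgesE // roughly_equalE => /andP[_].
have := card_label_compl _ (fun i => odd (\sum_(v in val (h i)) f v)).
by rewrite card_ord; lia.
Qed.

Lemma exists_cordial_add_edges (n : nat) (f : labeling (complete_graph n)) :
  1 < n -> friendly f ->
  exists h : 'I_(n %/ 2 - 1) -> vpair 'I_n,
    cordial (G := @add_edges (complete_graph n) _ h) f.
Proof.
move=> n_gt1 fF.
(* If all new edges are labeled 0, the surplus drops to exactly 1. *)
suff [h h0] : exists h : 'I_(n %/ 2 - 1) -> vpair 'I_n,
    forall i, odd (\sum_(v in val (h i)) f v) = false.
  exists h; rewrite cordial_add_edgesE //.
  have := card_label_compl _ (fun i => odd (\sum_(v in val (h i)) f v)).
  have -> : [set i | odd (\sum_(v in val (h i)) f v) == true] = set0.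
    by apply/setP => i; rewrite !inE h0.
  by rewrite cards0 card_ord roughly_equalE; lia.
(* For n = 2 or 3 there is nothing to add. From n = 4 on, two vertices share the label 1, and all
   new edges can be parallel copies of the pair they form. *)
have [n_lt4 | n_ge4] := ltnP n 4.
  have no_edge (i : 'I_(n %/ 2 - 1)) : False by case: i => i; lia.
  by exists (fun i => False_rect _ (no_edge i)) => i; case: (no_edge i).
have /card_gt1P[x [y]] : 1 < #|[set v | f v == true]|.
  move: fF; rewrite /friendly roughly_equalE.
  by have := card_label_compl _ f; rewrite /= card_ord; lia.
rewrite !inE => -[/eqP fx /eqP fy xy].
have sz : #|[set x; y]| == 2 by rewrite cards2 xy.
exists (fun=> Sub [set x; y] sz) => i.
by rewrite /= odd_sum_pair // fx fy.
Qed.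

Lemma exists_friendly (n : nat) :
  exists f : labeling (complete_graph n), friendly f.
Proof.
pose s := take (n %/ 2) (enum 'I_n).
pose f : labeling (complete_graph n) := [ffun v : 'I_n => v \in s].
have fT : #|[set v | f v == true]| = n %/ 2.
  transitivity #|s|; first by apply: eq_card => v; rewrite !inE ffunE eqb_id.
  rewrite (card_uniqP _) ?take_uniq ?enum_uniq // size_take_min size_enum_ord.
  by lia.
exists f; rewrite /friendly roughly_equalE.
by have := card_label_compl _ f; rewrite fT /= card_ord; lia.
Qed.

Theorem theorem2 (n : nat) (hn : 1 < n) :
  is_ced (complete_graph n) (n %/ 2 - 1).
Proof.
(* The lower bound holds for every friendly [f], so it settles both minima: over labelings here, and
   over edge counts for a fixed [f] below. *)
split=> [|j [f fF [[h hC] _]]]; last first.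
  exact: (cordial_add_edges_ge _ _ _ _ fF hC).
have [f fF] := exists_friendly n; exists f => //.
split=> [|j [h hC]]; first exact: exists_cordial_add_edges.
exact: (cordial_add_edges_ge _ _ _ _ fF hC).
Qed.
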